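(* Let $V$ be a real vector space with $\dim V=n$ and let $\phi\in\mathfrak{gl}(V)$ be nonderogatory. There exists a basis of $V$ in which the matrix $[\phi]$ of $\phi$ has a Jordan form; more precisely, the following hold (for the matrix in a suitable basis of $V$). (A) If $\phi$ has a unique (real) eigenvalue $\lambda$, with multiplicity $n$, then $[\phi]=\lambda\,\mathbb I_n+\sum_{i=1}^{n-1}E_{i,i+1}$. (B) If $\phi$ has $n$ distinct complex (nonreal) eigenvalues $\lambda_j,\bar\lambda_j$, $j=1,\dots,\frac n2$, then $[\phi]=\mathrm{diag}(J_1,\dots,J_{n/2})$ where $$J_j=\begin{pmatrix}\mathrm{Re}(\lambda_j)&-\mathrm{Im}(\lambda_j)\\ \mathrm{Im}(\lambda_j)&\mathrm{Re}(\lambda_j)\end{pmatrix},\qquad \mathrm{Im}(\lambda_j)\neq0.$$ (C) If $\phi$ has only two eigenvalues, both complex, $z=r+is$ and $\bar z$, where $r,s\in\mathbb R$, $s\ne0$, and if $n\ge4$, then $$[\phi]=r\,\mathbb I_n+sM_s+M_n .$$ (D) In the general case, $[\phi]$ is a block diagonal matrix with blocks of the forms in (A), (B), (C), or diagonal with distinct real diagonal entries.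
   Context: $\phi$ is nonderogatory if its characteristic and minimal polynomials coincide (up to sign). $E_{i,j}$ is the $n\times n$ matrix with $1$ in entry $(i,j)$ and $0$ elsewhere; $\mathbb I_n$ is the identity matrix. For even $n$, $M_s=-\sum_{j=0}^{n/2-1}(E_{2j+1,2j+2}-E_{2j+2,2j+1})$ and $M_n=\sum_{j=1}^{n-2}E_{j,j+2}$. In (D) the blocks may have any sizes summing to $n$, with the forms in (A), (B), (C) understood with $n$ replaced by the block size. *)

(* Defs.v *)
From HB Require Import structures.
From mathcomp Require Import all_boot all_order all_algebra.
From mathcomp Require Import complex reals.

Set Implicit Arguments.
Unset Strict Implicit.
Unset Printing Implicit Defensive.

Import Order.TTheory GRing.Theory Num.Theory passmx.

Local Open Scope ring_scope.

(* The matrix of phi in the basis e, in the column convention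
   phi e_j = \sum_i (mx_in e phi) i j *: e_i; the library's [mxof] acts on row
   vectors, hence the transposition. *)
Definition mx_in (F : fieldType) (V : vectType F)
    (e : (\dim {:V}).-tuple V) (phi : 'End(V)) : 'M[F]_(\dim {:V}) :=
  (mxof e e phi)^T.

(* The invariants below do not depend on the choice of the basis. *)
Definition mx_ref (F : fieldType) (V : vectType F) (phi : 'End(V)) :
    'M[F]_(\dim {:V}) :=
  mxof (vbasis {:V}) (vbasis {:V}) phi.

Definition char_poly_end (F : fieldType) (V : vectType F) (phi : 'End(V)) :
    {poly F} :=
  char_poly (mx_ref phi).

(* [mxminpoly] is only available in positive size; on the zero space the
   minimal polynomial is 1. *)
Definition minpoly_mx (F : fieldType) (n : nat) : 'M[F]_n -> {poly F} :=
  match n with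
  | 0 => fun=> 1
  | n'.+1 => fun A => mxminpoly A
  end.

Definition minpoly_end (F : fieldType) (V : vectType F) (phi : 'End(V)) :
    {poly F} :=
  minpoly_mx (mx_ref phi).

(* Both polynomials are monic ([char_poly] is \det ('X - A)), so that
   "equal up to sign" is plain equality. *)
Definition nonderogatory (F : fieldType) (V : vectType F) (phi : 'End(V)) :
    Prop :=
  char_poly_end phi = minpoly_end phi.

(* The eigenvalues of the complexification of phi. *)
Definition ceigenvalue (R : realType) (V : vectType R) (phi : 'End(V))
    (z : R[i]) : bool :=
  eigenvalue (map_mx (real_complex R) (mx_ref phi)) z.

(* The indices i, j of [Emx n i j] start from 1. *)
Definition Emx {R : pzRingType} (n i j : nat) : 'M[R]_n :=
  \matrix_(a, b) ((a.+1 == i) && (b.+1 == j))%:R.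

Definition Ms {R : pzRingType} (n : nat) : 'M[R]_n :=
  - \sum_(0 <= j < n./2)
      (Emx n (2 * j + 1) (2 * j + 2) - Emx n (2 * j + 2) (2 * j + 1)).

Definition Mn {R : pzRingType} (n : nat) : 'M[R]_n :=
  \sum_(1 <= j < n.-1) Emx n j (j + 2).

Definition jformA (R : realType) (n : nat) (lambda : R) : 'M[R]_n :=
  lambda%:M + \sum_(1 <= i < n) Emx n i (i + 1).

Definition Jmx (R : realType) (z : R[i]) : 'M[R]_2 :=
  \matrix_(a, b)
    if a == b then complex.Re z
    else if (a < b)%N then - complex.Im z else complex.Im z.

Definition jformB (R : realType) (m : nat) (lambda : 'I_m -> R[i]) :
    'M[R]_(\sum_(j < m) 2) :=
  \mxdiag_(j < m) Jmx (lambda j).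

Definition jformC (R : realType) (n : nat) (r s : R) : 'M[R]_n :=
  r%:M + s *: Ms n + Mn n.

Definition distinct_conj_pairs (R : realType) (m : nat)
    (lambda : 'I_m -> R[i]) : Prop :=
  (forall j, complex.Im (lambda j) != 0) /\
  uniq ([seq lambda j | j : 'I_m] ++ [seq conjc (lambda j) | j : 'I_m]).

Inductive jordan_block (R : realType) (n : nat) (M : 'M[R]_n) : Prop :=
| BlockA (lambda : R) of M = jformA n lambda
| BlockB (m : nat) (lambda : 'I_m -> R[i]) (hn : (\sum_(j < m) 2)%N = n)
    of distinct_conj_pairs lambda & M = castmx (hn, hn) (jformB lambda)
| BlockC (r s : R) of s != 0 & (4 <= n)%N & ~~ odd n & M = jformC n r s
| BlockDiag (d : 'rV[R]_n) of injective (d 0) & M = diag_mx d.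

(* Main.v *)
(* Nonderogatory matrices with the same characteristic polynomial c are
   similar: if c = \prod_i q_i ^ k_i with the q_i irreducible and pairwise
   coprime, then for each i some row vector has annihilator exactly q_i ^ k_i,
   and the sum of these vectors is cyclic; in the basis v, vA, vA^2, ... of a
   cyclic vector v the matrix A becomes the companion matrix of c. It is
   therefore enough that each Jordan form is nonderogatory with the prescribed
   characteristic polynomial. A block attached to q ^ k is so because
   q(B) ^ k = 0 != q(B) ^ (k - 1), and a block diagonal matrix inherits the
   property when the polynomials of its blocks are coprime. Over the reals the
   irreducible factors are X - a and (X - r)^2 + s^2, given by the roots in
   R[i]. *)
Require Import Defs.
From HB Require Import structures.
From mathcomp Require Import all_boot all_order all_algebra.
From mathcomp Require Import complex reals ring zify.

Set Implicit Arguments.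
Unset Strict Implicit.
Unset Printing Implicit Defensive.

Import Order.TTheory GRing.Theory Num.Theory.

Local Open Scope ring_scope.

(* [horner_mx] requires a positive size; the sizes [\dim {:V}] and
   [\sum_i p i] are not successors, hence this total version. *)
Definition hmx (F : fieldType) (n : nat) (p : {poly F}) : 'M[F]_n -> 'M[F]_n :=
  match n with
  | 0 => fun=> 0
  | n'.+1 => fun A => horner_mx A p
  end.

(** * Polynomials evaluated at matrices, minimal polynomials and cyclic vectors *)

Section PolynomialsInMatrices.
Variable F : fieldType.
Implicit Types p q c : {poly F}.

Lemma hmx_MXaddC n p a (A : 'M[F]_n) :
  hmx (p * 'X + a%:P) A = hmx p A *m A + a%:M.
Proof.
case: n A => [|n] A /=; first by rewrite [RHS]flatmx0.
by rewrite rmorphD rmorphM /= horner_mx_X horner_mx_C.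
Qed.

Lemma hmx0 n (A : 'M[F]_n) : hmx 0 A = 0.
Proof. by case: n A => [|n] A //=; rewrite raddf0. Qed.

Lemma hmxC n a (A : 'M[F]_n) : hmx a%:P A = a%:M.
Proof. by rewrite -[a%:P]add0r -(mul0r 'X) hmx_MXaddC hmx0 mul0mx add0r. Qed.

Lemma hmx1 n (A : 'M[F]_n) : hmx 1 A = 1%:M.
Proof. exact: hmxC. Qed.

Lemma hmxD n p q (A : 'M[F]_n) : hmx (p + q) A = hmx p A + hmx q A.
Proof. by case: n A => [|n] A /=; rewrite ?addr0 // raddfD. Qed.

Lemma hmxZ n a p (A : 'M[F]_n) : hmx (a *: p) A = a *: hmx p A.
Proof. by case: n A => [|n] A /=; rewrite ?scaler0 // linearZ. Qed.

Lemma hmxM n p q (A : 'M[F]_n) : hmx (p * q) A = hmx p A *m hmx q A.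
Proof. by case: n A => [|n] A /=; rewrite ?mul0mx // rmorphM. Qed.

Lemma hmxX n p k (A : 'M[F]_n) : hmx (p ^+ k) A = (hmx p A) ^+ k.
Proof. by elim: k => [|k IH]; rewrite ?hmx1 // !exprS hmxM IH. Qed.

Lemma hmx_dvdl m n p q (W : 'M_(m, n)) (A : 'M[F]_n) :
  p %| q -> W *m hmx p A = 0 -> W *m hmx q A = 0.
Proof.
by case/dvdpP=> r ->; rewrite [r * p]mulrC hmxM mulmxA => ->; rewrite mul0mx.
Qed.

Lemma hmx_Xn n k (A : 'M[F]_n) : hmx 'X^k A = A ^+ k.
Proof.
by rewrite hmxX; congr (_ ^+ k); case: n A => [|n] A /=;
  rewrite ?horner_mx_X ?[RHS]flatmx0.
Qed.

Lemma hmx_XsubC n a (A : 'M[F]_n) : hmx ('X - a%:P) A = A - a%:M.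
Proof.
rewrite -polyCN -['X]mul1r hmx_MXaddC hmx1 mul1mx; congr (_ + _).
exact: raddfN.
Qed.

Lemma hmx_tr n p (A : 'M[F]_n) : hmx p A^T = (hmx p A)^T.
Proof.
elim/poly_ind: p => [|p a IH]; first by rewrite !hmx0 trmx0.
have AC : hmx p A *m A = A *m hmx p A.
  by move: (hmxM p 'X A) (hmxM 'X p A); rewrite -['X]expr1 hmx_Xn expr1
     [_ * p]mulrC => <-.
by rewrite !hmx_MXaddC IH linearD /= tr_scalar_mx -trmx_mul AC.
Qed.

Lemma hmx_mxdiag k (s : 'I_k -> nat) (B : forall i, 'M[F]_(s i)) p :
  hmx p (\mxdiag_i B i) = \mxdiag_i hmx p (B i).
Proof.
elim/poly_ind: p => [|p a IH].
  by rewrite hmx0 -[LHS](@mxdiag0 _ k s); apply: eq_mxdiag => i; rewrite hmx0.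
rewrite hmx_MXaddC IH -mxdiagZ [X in _ *m X]/mxdiag mul_mxdiag_mxblock.
under [RHS]eq_mxdiag => i do rewrite hmx_MXaddC.
rewrite mxdiagD; congr (_ + _); apply: eq_mxblock => i j.
by case: eqVneq => [->|_]; rewrite ?mulmx0 // !conform_mx_id.
Qed.

(** With [W] the identity this concerns the annihilator of [A], with [W] a row vector that of the
    vector. If [p = u * q ^+ j] with [j < k] and [q] did not divide [u], Bezout for [u] and
    [q ^+ (k - j)] would write [q ^+ j] as a combination of [p] and [q ^+ k], so [q ^+ k.-1] would
    annihilate [W]. *)
Lemma irreducible_pow_dvd m n k (W : 'M[F]_(m, n)) (A : 'M[F]_n) q p :
    irreducible_poly q ->
    W *m hmx (q ^+ k) A = 0 -> W *m hmx (q ^+ k.-1) A != 0 ->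
    W *m hmx p A = 0 ->
  q ^+ k %| p.
Proof.
move=> irr_q Wk Wk1 Wp.
suff H : forall j, (j <= k)%N -> q ^+ j %| p by apply: H.
elim=> [_|j IH jk]; first by rewrite dvd1p.
have /dvdpP[u pE] := IH (ltnW jk).
suff : q %| u by move=> qu; rewrite pE exprS dvdp_mul.
rewrite -[q %| u]negbK -(irreducible_poly_coprime _ irr_q); apply/negP => cop.
have /(coprimep_expl (k - j)) /Bezout_eq1_coprimepP[[a b] /= ab1] := cop.
have Wj : W *m hmx (q ^+ j) A = 0.
  rewrite -[q ^+ j]mul1r -ab1 mulrDl -!mulrA -exprD subnK ?(ltnW jk) // -pE.
  by rewrite hmxD mulmxDr !(hmx_dvdl (dvdp_mull _ (dvdpp _))) ?addr0.
have jk1 : (j <= k.-1)%N by rewrite -ltnS prednK // (leq_ltn_trans _ jk).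
by move: Wk1; rewrite (hmx_dvdl (dvdp_exp2l q jk1) Wj) eqxx.
Qed.

(* Such a matrix is nonderogatory with characteristic polynomial [c]; requiring
   [c] to have size [n.+1] spares computing determinants of normal forms. *)
Definition has_minpoly n (A : 'M[F]_n) c :=
  [/\ c \is monic, size c = n.+1, hmx c A = 0 &
      forall p, hmx p A = 0 -> c %| p].

Lemma has_minpoly_char n (A : 'M[F]_n) :
  char_poly A = minpoly_mx A -> has_minpoly A (char_poly A).
Proof.
split; rewrite ?char_poly_monic ?size_char_poly //.
  by case: n A {H} => [|n] A //=; apply: Cayley_Hamilton.
rewrite H; case: n A {H} => [|n] A p /= pA; first by rewrite dvd1p.
exact: mxminpoly_min.
Qed.

Lemma monic_dvd_size_eq p q :
  p \is monic -> q \is monic -> size p = size q -> p %| q -> p = q.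
Proof.
move=> mp mq spq pq; apply/eqP; rewrite -eqp_monic //.
by rewrite -dvdp_size_eqp // spq.
Qed.

(* By Cayley-Hamilton, [c] divides the characteristic polynomial, which is
   monic of the same size; hence [hmx c A = 0] comes for free. *)
Lemma has_minpolyI n (A : 'M[F]_n) c :
    c \is monic -> size c = n.+1 -> (forall p, hmx p A = 0 -> c %| p) ->
  has_minpoly A c.
Proof.
move=> mc sc minc; split=> //.
have CH : hmx (char_poly A) A = 0.
  by case: n A {sc minc} => [|n] A //=; apply: Cayley_Hamilton.
rewrite (monic_dvd_size_eq mc (char_poly_monic A)) ?size_char_poly //.
exact: minc.
Qed.

(** Used because [mx_in] transposes the matrix acting on row vectors, so that the target forms have
    to be transposed as well. *)
Lemma has_minpoly_tr n (A : 'M[F]_n) c : has_minpoly A c -> has_minpoly A^T c.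
Proof.
case=> mc sc _ minc; apply: has_minpolyI => // p.
by rewrite hmx_tr -[X in _ = X -> _]trmx0 => /trmx_inj/minc.
Qed.

Lemma has_minpoly_cast n m (e : n = m) (A : 'M[F]_n) c :
  has_minpoly A c -> has_minpoly (castmx (e, e) A) c.
Proof. by case: m / e; rewrite castmx_id. Qed.

Lemma has_minpoly_irr n (A : 'M[F]_n) q k :
    irreducible_poly q -> q \is monic -> (k * (size q).-1)%N = n ->
    hmx q A ^+ k = 0 -> hmx q A ^+ k.-1 != 0 ->
  has_minpoly A (q ^+ k).
Proof.
move=> irr_q mq skq qk qk1; apply: has_minpolyI.
- exact: monic_exp.
- rewrite -skq mulnC -size_exp prednK // size_poly_gt0.
  by rewrite expf_neq0 ?monic_neq0.
move=> p pA.
by apply: (irreducible_pow_dvd (A := A) (W := 1%:M));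
  rewrite ?hmxX ?pA ?mulmx0 ?mul1mx.
Qed.

Lemma prod_coprime_dvd (I : eqType) (s : seq I) (c : I -> {poly F}) p :
    pairwise (fun i j => coprimep (c i) (c j)) s ->
    (forall i, i \in s -> c i %| p) ->
  \prod_(i <- s) c i %| p.
Proof.
elim: s => [|i s IH] /= in p *; first by rewrite big_nil dvd1p.
case/andP=> /allP cop pw dv; rewrite big_cons Gauss_dvdp.
  rewrite dv ?mem_head ?IH // => j js; apply: dv; exact: mem_behead.
rewrite big_seq; elim/big_ind: _ => [|x y cx cy|j /cop //].
  exact: coprimep1.
by rewrite coprimepMr cx.
Qed.

Lemma prod_ord_coprime_dvd k (c : 'I_k -> {poly F}) p :
    (forall i j : 'I_k, (i < j)%N -> coprimep (c i) (c j)) ->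
    (forall i, c i %| p) ->
  \prod_i c i %| p.
Proof.
move=> cop dv; rewrite -big_enum; apply: prod_coprime_dvd => // {p dv}.
have: pairwise (fun i j : 'I_k => (i < j)%N) (enum 'I_k).
  rewrite -(pairwise_map (val : 'I_k -> nat) ltn) val_enum_ord.
  by rewrite -sorted_pairwise ?iota_ltn_sorted //; apply: ltn_trans.
by apply: sub_pairwise => i j; apply: cop.
Qed.

Lemma has_minpoly_mxdiag k (s : 'I_k -> nat) (B : forall i, 'M[F]_(s i))
    (c : 'I_k -> {poly F}) :
    (forall i, has_minpoly (B i) (c i)) ->
    (forall i j : 'I_k, (i < j)%N -> coprimep (c i) (c j)) ->
  has_minpoly (\mxdiag_i B i) (\prod_i c i).
Proof.
move=> mB cop; apply: has_minpolyI.
- by apply: monic_prod => i _; case: (mB i).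
- rewrite size_prod; last by move=> i _; case: (mB i) => /monic_neq0.
  rewrite (eq_bigr (fun i => s i + 1)%N); last first.
    by move=> i _; rewrite addn1; case: (mB i).
  by rewrite big_split /= sum1_card -addSn addnK.
move=> p; rewrite hmx_mxdiag -(@mxdiag0 _ k s) => /eq_mxdiagP pB.
by apply: prod_ord_coprime_dvd => // i; case: (mB i) => _ _ _; apply.
Qed.

Definition krylov n (A : 'M[F]_n) (v : 'rV_n) : 'M_n :=
  \matrix_i (v *m A ^+ i).

(** Combinations of Krylov rows are polynomials in [A] of degree below [n] applied to [v]; linear
    independence becomes a question of divisibility. *)
Lemma mul_krylov n (A : 'M[F]_n) v u :
  u *m krylov A v = v *m hmx (rVpoly u) A.
Proof.
have -> : rVpoly u = \sum_i u 0 i *: 'X^i.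
  rewrite [LHS]poly_def; apply: eq_bigr => i _.
  by rewrite valK.
rewrite mulmx_sum_row; elim/big_ind2: _ => [|x p y q -> ->|i _].
- by rewrite hmx0 mulmx0.
- by rewrite hmxD mulmxDr.
- by rewrite rowK hmxZ hmx_Xn scalemxAr.
Qed.

(* The Krylov rows of a cyclic vector conjugate [A] to a matrix depending only
   on [c], the companion matrix of [c]. *)
Lemma krylov_companion n (A : 'M[F]_n) c (v : 'rV_n) :
    has_minpoly A c -> (forall p, v *m hmx p A = 0 -> c %| p) ->
  krylov A v \in unitmx /\
  krylov A v *m A = (\matrix_(i < n) poly_rV ('X^(i.+1) %% c)) *m krylov A v.
Proof.
move=> [mc sc cA _] cyc; split.
  (* A row of the kernel encodes a polynomial of degree below [n] divisible by [c], which has degree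
     [n]; so it is zero. *)
  rewrite -row_free_unit -kermx_eq0; apply/eqP/row_matrixP => i.
  have: row i (kermx (krylov A v)) *m krylov A v = 0.
    by rewrite -row_mul mulmx_ker row0.
  rewrite mul_krylov row0 => /cyc cu; rewrite -[LHS]rVpolyK.
  suff -> : rVpoly (row i (kermx (krylov A v))) = 0 by rewrite raddf0.
  apply/eqP; apply: contraT => /dvdp_leq/(_ cu).
  by rewrite sc leqNgt ltnS size_poly.
apply/row_matrixP => i; rewrite !row_mul !rowK mul_krylov poly_rV_K; last first.
  by rewrite -ltnS -sc ltn_modp monic_neq0.
rewrite -mulmxA -[_ *m A]/(_ ^+ _ * _) -exprSr -hmx_Xn.
by rewrite {1}(divp_eq 'X^(i.+1) c) hmxD hmxM cA mulmx0 add0r.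
Qed.

Lemma cyclic_similar n (A B : 'M[F]_n) c (v w : 'rV_n) :
    has_minpoly A c -> (forall p, v *m hmx p A = 0 -> c %| p) ->
    has_minpoly B c -> (forall p, w *m hmx p B = 0 -> c %| p) ->
  exists2 P : 'M_n, P \in unitmx & P *m A = B *m P.
Proof.
move=> mA cA mB cB.
have [uA KA] := krylov_companion mA cA; have [uB KB] := krylov_companion mB cB.
exists (invmx (krylov B w) *m krylov A v).
  by rewrite unitmx_mul unitmx_inv uB.
apply: (can_inj (mulKmx uB)).
by rewrite -!mulmxA mulKVmx // KA !mulmxA KB -!mulmxA mulKVmx.
Qed.

Lemma cyclic_vector (I : eqType) (q : I -> {poly F}) (k : I -> nat)
    (s : seq I) n (A : 'M[F]_n) c :
    has_minpoly A c -> c = \prod_(i <- s) q i ^+ k i ->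
    (forall i, i \in s -> irreducible_poly (q i) /\ (0 < k i)%N) ->
    pairwise (fun i j => coprimep (q i ^+ k i) (q j ^+ k j)) s ->
  exists v : 'rV_n, forall p, v *m hmx p A = 0 -> c %| p.
Proof.
move=> [mc _ cA minc] cE.
(* The cofactor [r] keeps [c] fixed during the induction on [s]: it absorbs the factors already
   split off. *)
have [r cr] : exists r, c = r * \prod_(i <- s) q i ^+ k i.
  by exists 1; rewrite mul1r.
move=> irr pw.
suff [v [_ vP]]: exists v : 'rV_n, v *m hmx (\prod_(i <- s) q i ^+ k i) A = 0 /\
    forall p, v *m hmx p A = 0 -> \prod_(i <- s) q i ^+ k i %| p.
  by exists v => p /vP; rewrite -cE.
elim: s r cr irr pw {cE} => [|i s IH] r cr irr pw.
  exists 0; split=> [|p _]; first by rewrite mul0mx.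
  by rewrite big_nil dvd1p.
move: cr pw; rewrite big_cons /= => cr /andP[/allP cop pw].
set d := \prod_(i <- s) _ in cr *.
have {}IH : exists v : 'rV_n, v *m hmx d A = 0 /\
    forall p, v *m hmx p A = 0 -> d %| p.
  apply: (IH (r * q i ^+ k i)) => //; first by rewrite -mulrA.
  by move=> j js; apply: irr; apply: mem_behead.
have [irr_q k0] := irr _ (mem_head _ _).
have copd : coprimep (q i ^+ k i) d.
  rewrite /d big_seq; elim/big_ind: _ => [|x y cx cy|j /cop //].
    exact: coprimep1.
  by rewrite coprimepMr cx.
have q0 : q i != 0 by apply: irredp_neq0.
have rd0 : r * d != 0.
  have := monic_neq0 mc; rewrite cr mulrCA mulf_eq0 negb_or => /andP[] //.
(* By minimality of [c], its proper divisor [c / q i] does not kill [A]. Hence [w], the image of [u]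
   under [r * d], has annihilator exactly [q i ^+ k i]. *)
have [u uN0] : exists u : 'rV_n, u *m hmx (r * d * q i ^+ (k i).-1) A != 0.
  set x := r * d * _; have x0 : x != 0 by rewrite mulf_neq0 ?expf_neq0.
  have: hmx x A != 0.
    apply: contraTN isT => /eqP/minc /(dvdp_leq x0).
    have -> : c = x * q i by rewrite cr -[in LHS](prednK k0) exprS /x; ring.
    rewrite size_mul // -subn1 leq_subLR addnC leq_add2r leqNgt.
    by case: irr_q => ->.
  by case/rowV0Pn => _ /submxP[u ->] uN0; exists u.
have [v [vd vP]] := IH.
pose w := u *m hmx (r * d) A.
have wq : w *m hmx (q i ^+ k i) A = 0.
  by rewrite -mulmxA -hmxM -mulrA [d * _]mulrC -cr cA mulmx0.
have wP p : w *m hmx p A = 0 -> q i ^+ k i %| p.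
  by move=> wp; apply: irreducible_pow_dvd irr_q wq _ wp; rewrite -mulmxA -hmxM.
exists (v + w); split=> [|p].
  rewrite mulmxDl (hmx_dvdl (dvdp_mull _ (dvdpp _)) vd).
  by rewrite (hmx_dvdl (dvdp_mulr _ (dvdpp _)) wq) addr0.
rewrite mulmxDl => /eqP; rewrite addr_eq0 => /eqP vwp.
(* Multiplying [p] by [d] kills the [v] part and isolates [w]; multiplying it by [q i ^+ k i]
   isolates [v]. Coprimality then removes the extra factor. *)
rewrite Gauss_dvdp //; apply/andP; split.
  have : w *m hmx (p * d) A = 0.
    rewrite hmxM mulmxA -[w *m _]opprK -vwp mulNmx -mulmxA -hmxM.
    by rewrite (hmx_dvdl (dvdp_mull _ (dvdpp _)) vd) oppr0.
  by move/wP; rewrite Gauss_dvdpl.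
have : v *m hmx (p * q i ^+ k i) A = 0.
  rewrite hmxM mulmxA vwp mulNmx -mulmxA -hmxM.
  by rewrite (hmx_dvdl (dvdp_mull _ (dvdpp _)) wq) oppr0.
by move/vP; rewrite Gauss_dvdpl // coprimep_sym.
Qed.

End PolynomialsInMatrices.

(** * Irreducible factorization of real polynomials through complex roots *)

Lemma max_pow_factor (F : fieldType) (p q : {poly F}) :
  p != 0 -> (1 < size q)%N -> exists k r, ~~ (q %| r) /\ p = q ^+ k * r.
Proof.
move=> p0 sq; have [n] := ubnP (size p); elim: n p p0 => // n IH p p0 sp.
have [/dvdpP[r pE]|qp] := boolP (q %| p); last by exists 0%N, p; rewrite mul1r.
have [r0 q0] : r != 0 /\ q != 0 by apply/andP; rewrite -negb_or -mulf_eq0 -pE.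
have [|k [u [qu rE]]] := IH r r0.
  rewrite -ltnS (leq_trans _ sp) // pE size_mul // ltnS.
  by case: (size q) sq => [|[|a]] // _; rewrite !addnS /= ltnS leq_addr.
by exists k.+1, u; rewrite pE rE exprS mulrC mulrA.
Qed.

Section RealIrreducibles.
Variable R : rcfType.
Implicit Types (z w : R[i]) (p q : {poly R}).

Local Notation toC := (map_poly (real_complex R)).

(** The minimal polynomial of [z] over the reals, equal to [(X - z)(X - conjc z)] when [z] is not
    real; the completed square is easy to evaluate at a matrix. *)
Definition real_min z : {poly R} :=
  if complex.Im z == 0 then 'X - (complex.Re z)%:P
  else ('X - (complex.Re z)%:P) ^+ 2 + (complex.Im z ^+ 2)%:P.

Lemma size_real_min z : size (real_min z) = if complex.Im z == 0 then 2 else 3.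
Proof.
rewrite /real_min; case: ifP => _; first by rewrite size_XsubC.
by rewrite size_polyDl size_exp_XsubC // (leq_ltn_trans (size_polyC_leq1 _)).
Qed.

Lemma real_min_monic z : real_min z \is monic.
Proof.
rewrite /real_min; case: ifP => _; first exact: monicXsubC.
rewrite monicE lead_coefDl; last first.
  by rewrite size_exp_XsubC (leq_ltn_trans (size_polyC_leq1 _)).
by rewrite -monicE monic_exp ?monicXsubC.
Qed.

Lemma root_real_min z w :
  root (toC (real_min z)) w = (w == z) || (w == conjc z).
Proof.
have zE : z = Complex (complex.Re z) (complex.Im z) by case: z.
rewrite /real_min; case: eqP => [z0|_].
  rewrite map_polyXsubC root_XsubC.
  by rewrite {2 3}zE z0 /= oppr0 orbb.
rewrite rmorphD rmorphXn /= map_polyXsubC map_polyC /=.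
have -> : ('X - (real_complex R (complex.Re z))%:P) ^+ 2
    + (real_complex R (complex.Im z ^+ 2))%:P
    = ('X - z%:P) * ('X - (conjc z)%:P) :> {poly R[i]}.
  have zD : z + conjc z = real_complex R (complex.Re z + complex.Re z).
    by rewrite {1 2}zE; apply/eqP; rewrite eq_complex /= addrN !eqxx.
  have zM :
      z * conjc z = real_complex R (complex.Re z ^+ 2 + complex.Im z ^+ 2).
    rewrite {1 2}zE; apply/eqP; rewrite eq_complex /=.
    by apply/andP; split; apply/eqP; ring.
  transitivity
    ('X ^+ 2 - (z + conjc z)%:P * 'X + (z * conjc z)%:P : {poly R[i]}).
    by rewrite zD zM !rmorphD /= !rmorphXn /=; ring.
  by rewrite polyCD polyCM; ring.
by rewrite rootM !root_XsubC.
Qed.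

(** The remainder of [p] has the form [a + b X], with [b = 0] when [z] is real. If it vanishes at a
    nonreal [z], its imaginary part gives [b = 0], and then [a = 0]. *)
Lemma real_min_dvd z p : (real_min z %| p) = root (toC p) z.
Proof.
apply/idP/idP => [/dvdpP[r ->]|].
  by rewrite rmorphM rootM root_real_min eqxx orbT.
have zE : z = Complex (complex.Re z) (complex.Im z) by case: z.
rewrite {1}(divp_eq p (real_min z)) rmorphD rmorphM /= /root hornerD hornerM.
have /eqP -> : root (toC (real_min z)) z by rewrite root_real_min eqxx.
rewrite mulr0 add0r /dvdp.
have: (size (p %% real_min z)%R < size (real_min z))%N.
  by rewrite ltn_modp monic_neq0 ?real_min_monic.
rewrite size_real_min; case: eqP => [z0|/eqP z0] sr.
  move: (sr); rewrite ltnS => /size1_polyC ->.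
  by rewrite map_polyC hornerC polyC_eq0 fmorph_eq0.
have -> : p %% real_min z =
    ((p %% real_min z)`_0)%:P + ((p %% real_min z)`_1)%:P * 'X.
  apply/polyP=> -[|[|k]]; rewrite coefD coefC coefMX coefC /= ?addr0 ?add0r //.
  by rewrite nth_default // -ltnS (leq_trans sr).
move: (_`_0) (_`_1) => a b.
rewrite rmorphD rmorphM /= !map_polyC map_polyX.
rewrite hornerD hornerM !hornerC hornerX.
rewrite zE eq_complex /= => /andP[]; rewrite !mul0r subr0 addr0 add0r.
move=> + /eqP/eqP; rewrite mulf_eq0 (negPf z0) orbF => + /eqP b0.
by rewrite b0 mul0r addr0 => /eqP ->; rewrite mul0r addr0.
Qed.

(** In degree 2 the absence of real roots suffices, and the complex roots [z] and [conjc z] are not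
    real. *)
Lemma real_min_irreducible z : irreducible_poly (real_min z).
Proof.
have [z0|z0] := boolP (complex.Im z == 0).
  by rewrite /real_min z0; apply: irredp_XsubC.
apply: cubic_irreducible => [|x]; first by rewrite size_real_min; case: ifP.
rewrite -(fmorph_root (real_complex R)) root_real_min.
case: z z0 => a b /= z0; rewrite negb_or !eq_complex /= !(eq_sym 0) oppr_eq0.
by rewrite (negPf z0) !andbF.
Qed.

Lemma coprime_real_min z w :
  w != z -> w != conjc z -> coprimep (real_min z) (real_min w).
Proof.
move=> wz wz'; rewrite irreducible_poly_coprime; last first.
  exact: real_min_irreducible.
rewrite real_min_dvd root_real_min negb_or eq_sym wz /=.
by rewrite -(inj_eq (can_inj (@conjcK R))) conjcK eq_sym.
Qed.

(** [R[i]] is algebraically closed, so [p] has a complex root [z]; the highest power of [real_min z]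
    is split off. *)
Lemma real_root_factor p : p \is monic -> p != 1 ->
  exists z k r, [/\ (0 < k)%N, r \is monic,
    p = real_min z ^+ k * r & coprimep (real_min z) r].
Proof.
move=> mp p1.
have : size (toC p) != 1%N.
  rewrite size_map_poly; apply: contraNneq p1 => /eqP/size_poly1P[a _ pa].
  by move: mp; rewrite pa monicE lead_coefC => /eqP->.
case/closed_rootP=> z; rewrite -real_min_dvd => zp.
have sz : (1 < size (real_min z))%N by rewrite size_real_min; case: ifP.
have [k [r [kr pE]]] := max_pow_factor (monic_neq0 mp) sz.
exists z, k, r; split=> //.
- case: k pE => // pE.
  by move: kr; rewrite -[r]mul1r -(expr0 (real_min z)) -pE zp.
- by rewrite -(monicMl _ (monic_exp k (real_min_monic z))) -pE.
by rewrite irreducible_poly_coprime //; apply: real_min_irreducible.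
Qed.

Lemma real_factorization p : p \is monic ->
  exists s : seq (R[i] * nat),
    [/\ p = \prod_(x <- s) real_min x.1 ^+ x.2, all (fun x => 0 < x.2)%N s &
        pairwise (fun x y =>
          coprimep (real_min x.1 ^+ x.2) (real_min y.1 ^+ y.2)) s].
Proof.
have [n] := ubnP (size p); elim: n p => // n IH p sp mp.
have [->|p1] := eqVneq p 1; first by exists [::]; rewrite big_nil.
have [z [k [r [k0 mr pE cop]]]] := real_root_factor mp p1.
have [|s [rE s0 sc]] := IH r _ mr.
  rewrite -ltnS (leq_trans _ sp) // pE size_monicM ?monic_exp
    ?real_min_monic ?monic_neq0 //.
  have : (1 < size (real_min z ^+ k))%N.
    rewrite -[X in (1 < X)%N]prednK ?size_poly_gt0 ?expf_neq0 ?monic_neq0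
      ?real_min_monic //.
    rewrite size_exp size_real_min; by case: ifP; case: k k0 {pE}.
  by case: (size _) => [|[|a]] //; rewrite !addSn /= !ltnS leq_addl.
exists ((z, k) :: s); split; rewrite /= ?big_cons ?k0 -?rE // sc andbT.
apply/allP => x xs; rewrite coprimep_expl //; apply: coprimep_dvdl cop.
by rewrite rE (big_rem x xs) /= dvdp_mulr.
Qed.

End RealIrreducibles.

(** * Superdiagonal matrices and [Ms], through their action on row vectors *)

Section ShiftMatrices.
Variable R : pzRingType.

(* [nat_delta n a] is the [a]-th row vector of the canonical basis if [a < n],
   and 0 otherwise. *)
Definition nat_delta n (a : nat) : 'rV[R]_n := \row_j (j == a :> nat)%:R.

Lemma nat_delta_ord n (i : 'I_n) : nat_delta n i = delta_mx 0 i.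
Proof. by apply/rowP=> j; rewrite !mxE eqxx. Qed.

Lemma nat_delta_default n a : (n <= a)%N -> nat_delta n a = 0.
Proof.
by move=> na; apply/rowP=> j; rewrite !mxE ltn_eqF // (leq_trans _ na).
Qed.

Lemma nat_delta_mxP n m (A B : 'M[R]_(n, m)) :
  (forall a, nat_delta n a *m A = nat_delta n a *m B) -> A = B.
Proof. by move=> AB; apply/row_matrixP=> i; rewrite !rowE -nat_delta_ord. Qed.

(** The [k]-th power of the nilpotent Jordan block; [k = 1] occurs in [jformA] and [k = 2] is
    [Mn]. *)
Definition shift_mx n k : 'M[R]_n := \matrix_(i, j) (j == i + k :> nat)%N%:R.

Lemma nat_delta_shift n k a :
  nat_delta n a *m shift_mx n k = nat_delta n (a + k).
Proof.
have [na|an] := leqP n a.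
  by rewrite !nat_delta_default ?mul0mx // (leq_trans na) ?leq_addr.
rewrite -[a]/(val (Ordinal an)) nat_delta_ord -rowE.
by apply/rowP=> j; rewrite !mxE.
Qed.

Lemma shift_mxX n k m : shift_mx n k ^+ m = shift_mx n (k * m).
Proof.
apply: nat_delta_mxP => a; rewrite nat_delta_shift.
elim: m => [|m IH] in a *; first by rewrite muln0 addn0 expr0 mulmx1.
by rewrite exprS -[_ * _]/(_ *m _) mulmxA nat_delta_shift IH mulnS addnA.
Qed.

Lemma shift_mx_default n k : (n <= k)%N -> shift_mx n k = 0.
Proof.
move=> nk; apply: nat_delta_mxP => a.
by rewrite nat_delta_shift mulmx0 nat_delta_default // (leq_trans nk) ?leq_addl.
Qed.

(** The hypothesis expresses [m - 1 = n - k] (truncated), which holds for [jformA] and [Mn] even in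
    small sizes. *)
Lemma sum_Emx_shift n k m : (forall a, (a + k < n)%N = (a.+1 < m)%N) ->
  \sum_(1 <= l < m) Emx n l (l + k) = shift_mx n k.
Proof.
move=> Hm; apply/matrixP=> i j; rewrite summxE !mxE.
under eq_bigr => l _.
  have -> : Emx n l (l + k) i j =
      if l == i.+1 then (j == i + k :> nat)%N%:R else 0 :> R.
    rewrite mxE eq_sym; case: eqP => [->|] //=; by rewrite addSn eqSS.
  over.
rewrite -big_mkcond big_nat1_eq /=; case: ifP => // /negbT im.
case: eqP => // ji; move: im; rewrite -Hm -ji ltn_ord //.
Qed.

(** [Ms] is a complex structure made of quarter turns on consecutive pairs of basis vectors, here
    numbered from 0. *)
Lemma nat_delta_Ms n a : ~~ odd n ->
  nat_delta n a *m Ms n =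
    if odd a then nat_delta n a.-1 else - nat_delta n a.+1.
Proof.
move=> en; have [na|an] := leqP n a.
  (* Evenness of [n] ensures that no pair straddles the bound: an odd [a >= n] has [a.-1 >= n]. *)
  have na1 : odd a -> (n <= a.-1)%N by lia.
  by case: ifP => [/na1 na2|_]; rewrite !nat_delta_default ?mul0mx ?oppr0 ?leqW.
rewrite -[nat_delta n a]/(nat_delta n (Ordinal an)) nat_delta_ord -rowE.
apply/rowP=> j; rewrite !mxE summxE.
(* Row [a] meets only the summand of index [a./2]. *)
have a2 : (a./2 < n./2)%N by lia.
under eq_bigr => l _.
  rewrite !mxE.
  have -> : ((a.+1 == 2 * l + 1) && (j.+1 == 2 * l + 2))%N%:R
     - ((a.+1 == 2 * l + 2) && (j.+1 == 2 * l + 1))%N%:R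
     = if l == a./2 then
         (~~ odd a && (j == a.+1 :> nat))%:R - (odd a && (j == a.-1 :> nat))%:R
       else 0 :> R.
    case: (eqVneq l a./2) => [->|la].
      have -> : (a.+1 == 2 * a./2 + 1)%N && (j.+1 == 2 * a./2 + 2)%N =
          ~~ odd a && (j == a.+1 :> nat) by lia.
      have -> // : (a.+1 == 2 * a./2 + 2)%N && (j.+1 == 2 * a./2 + 1)%N =
          odd a && (j == a.-1 :> nat) by lia.
    have -> : (a.+1 == 2 * l + 1)%N = false by lia.
    have -> : (a.+1 == 2 * l + 2)%N = false by lia.
    by rewrite subr0.
  over.
rewrite -big_mkcond big_nat1_eq a2 /=; case: (odd a) => /=.
  by rewrite mxE sub0r opprK.
by rewrite !mxE subr0.
Qed.

End ShiftMatrices.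

(** * Minimal polynomials of the individual Jordan blocks *)

Section JordanBlocks.
Variable R : realType.

Lemma jformA_minpoly n (a : R) :
  (0 < n)%N -> has_minpoly (jformA n a) (('X - a%:P) ^+ n).
Proof.
move=> n0; rewrite /jformA (@sum_Emx_shift R n 1 n); last first.
  by move=> b; rewrite addn1.
apply: has_minpoly_irr; rewrite ?monicXsubC ?size_XsubC ?muln1 //.
- exact: irredp_XsubC.
- by rewrite hmx_XsubC addrAC subrr add0r shift_mxX mul1n shift_mx_default.
rewrite hmx_XsubC addrAC subrr add0r shift_mxX mul1n.
(* The shift by [n.-1] sends the first basis row vector to the last one. *)
apply/eqP => /(congr1 (mulmx (nat_delta R n 0))).
rewrite nat_delta_shift mulmx0 => /rowP.
have lt1 : (n.-1 < n)%N by rewrite prednK.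
move=> /(_ (Ordinal lt1)); rewrite !mxE eqxx => /eqP.
by rewrite oner_eq0.
Qed.

Lemma Jmx_minpoly (z : R[i]) :
  complex.Im z != 0 -> has_minpoly (Jmx z) (real_min z).
Proof.
move=> z0; rewrite -[real_min z]expr1; apply: has_minpoly_irr.
- exact: real_min_irreducible.
- exact: real_min_monic.
- by rewrite size_real_min (negPf z0).
- rewrite expr1 /real_min (negPf z0) hmxD hmxX hmx_XsubC hmxC.
  apply/matrixP=> i j; rewrite expr2 !mxE !big_ord_recl big_ord0 !mxE.
  by case: i j => [[|[|?]] ?] [[|[|?]] ?] //=; rewrite ?mulr1n ?mulr0n; ring.
by rewrite expr0 oner_eq0.
Qed.

(* With [J := Ms n] and [N := shift_mx n 2] we have [J^2 = -1] and [JN = NJ],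
   hence [(sJ + N)^2 + s^2 = N (2sJ + N)], and [J] is invertible. *)
Lemma jformC_minpoly n (r s : R) :
    s != 0 -> (0 < n)%N -> ~~ odd n ->
  has_minpoly (jformC n r s) (real_min (Complex r s) ^+ n./2).
Proof.
move=> s0 n0 en; rewrite /jformC /Mn (@sum_Emx_shift R n 2); last first.
  by move=> a; lia.
have sAl a (X Y : 'M[R]_n) : a *: X * Y = a *: (X * Y).
  exact/esym/scalemxAl.
have sAr a (X Y : 'M[R]_n) : X * (a *: Y) = a *: (X * Y).
  exact/esym/scalemxAr.
set J : 'M[R]_n := Ms n; set N : 'M[R]_n := shift_mx R n 2.
have JJ : J * J = - 1%:M.
  apply: nat_delta_mxP => a; rewrite -[J * J]/(J *m J) mulmxA nat_delta_Ms //.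
  rewrite mulmxN mulmx1.
  case: ifP => oa; rewrite ?mulNmx nat_delta_Ms //; last first.
    by rewrite oddS oa.
  by case: a oa => //= a /negPf->.
have JN : J * N = N * J.
  apply: nat_delta_mxP => a.
  rewrite -[J * N]/(J *m N) -[N * J]/(N *m J) !mulmxA.
  rewrite nat_delta_Ms // [in RHS]nat_delta_shift nat_delta_Ms // oddD addbF.
  case: ifP => oa; rewrite ?mulNmx nat_delta_shift ?addn2 //.
  by case: a oa.
have [t tE] : exists t, t = s + s by exists (s + s).
set W : 'M[R]_n := t *: J + N.
have WN : N * W = W * N.
  by rewrite /W mulrDr mulrDl sAl sAr JN.
have qA : hmx (real_min (Complex r s)) (r%:M + s *: J + N) = N * W.
  rewrite /real_min /= (negPf s0) hmxD hmxX hmx_XsubC hmxC.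
  have -> : r%:M + s *: J + N - r%:M = s *: J + N.
    by rewrite addrAC [r%:M + _]addrC addrK.
  rewrite expr2 mulrDl !mulrDr !sAl !sAr scalerA JJ JN.
  rewrite -[(s ^+ 2)%:M]scalemx1 expr2.
  by rewrite tE scalerDl scalerN addrC !addrA subrr add0r.
(* [W] preserves the kernel of [N], where it acts as [t *: J]; this is injective because [t = 2s] is
   nonzero and [J * J = -1]. *)
have wz (x : 'rV_n) k : x != 0 -> x *m N = 0 ->
    x *m W ^+ k != 0 /\ x *m W ^+ k *m N = 0.
  move=> x0 xN; elim: k => [|k [IH IHN]]; first by rewrite mulmx1.
  rewrite exprSr -[_ * W]/(_ *m W) mulmxA; split; last first.
    by rewrite -mulmxA -[W *m N]WN mulmxA IHN mul0mx.
  have -> : x *m W ^+ k *m W = t *: (x *m W ^+ k *m J).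
    by rewrite [LHS]mulmxDr IHN addr0 -scalemxAr.
  rewrite scaler_eq0 tE -mulr2n mulrn_eq0 (negPf s0) /=.
  apply: contraNneq IH => xJ; rewrite -[_ *m _]opprK -[X in - - X]mulmx1.
  by rewrite -mulmxN -JJ -[J * J]/(J *m J) mulmxA xJ mul0mx oppr0.
have NWk k : (N * W) ^+ k = shift_mx R n (2 * k) * W ^+ k.
  by rewrite exprMn_comm // shift_mxX.
apply: has_minpoly_irr.
- exact: real_min_irreducible.
- exact: real_min_monic.
- by rewrite size_real_min /= (negPf s0) /=; lia.
- by rewrite qA NWk shift_mx_default ?mul0r //; lia.
(* The power [n./2.-1] of [N] sends basis vector 0 to basis vector [n - 2], a nonzero vector of the
   kernel of [N], so [wz] applies. *)
rewrite qA NWk; apply/eqP => /(congr1 (mulmx (nat_delta R n 0))).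
rewrite -[_ * _]/(_ *m _) mulmxA nat_delta_shift mulmx0 => /eqP; apply/negP.
apply: (proj1 (wz _ _ _ _)).
  have lt : (0 + 2 * n./2.-1 < n)%N by lia.
  apply/eqP => /rowP/(_ (Ordinal lt)); rewrite !mxE eqxx => /eqP.
  by rewrite oner_eq0.
by rewrite nat_delta_shift nat_delta_default //; lia.
Qed.

End JordanBlocks.

(** * From similar matrices to bases of [V] *)

Section BasisChange.
Import passmx.

(** The rows of [P] are the coordinates of the new basis vectors in the reference basis; [T] is
    transposed to match the column convention of [mx_in]. *)
Lemma mx_in_similar (F : fieldType) (V : vectType F) (phi : 'End(V))
    (P T : 'M_(\dim {:V})) :
    P \in unitmx -> P *m mx_ref phi = T^T *m P ->
  exists2 e : (\dim {:V}).-tuple V, basis_of {:V} e & mx_in e phi = T.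
Proof.
rewrite /mx_ref; have bb := vbasisP {:V}; move: (vbasis _) bb => b bb uP PT.
pose e := [tuple vecof b (row i P) | i < \dim {:V}].
have eE u : vecof e u = vecof b (u *m P).
  rewrite mulmx_sum_row linear_sum; apply: eq_bigr => i _.
  by rewrite linearZ (nth_mktuple (fun i => vecof b (row i P))).
have be : basis_of {:V} e.
  rewrite basisEfree size_tuple leqnn subvf !andbT.
  apply/freeP => k k0 i.
  have /eqP : vecof e (\row_j k j) = 0.
    by rewrite -[RHS]k0; apply: eq_bigr => j _; rewrite mxE.
  rewrite eE vecof_eq0 // => /eqP kP.
  have: (\row_j k j) *m P *m invmx P = 0 by rewrite kP mul0mx.
  by rewrite mulmxK // => /rowP/(_ i); rewrite !mxE.
exists e => //; rewrite /mx_in -[RHS]trmxK; congr _^T.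
apply/row_matrixP => i; rewrite !rowE mul_mxof eE (hom_vecof _ bb) -mulmxA PT.
by rewrite mulmxA -eE vecofK.
Qed.

End BasisChange.

(** * Realizing a matrix with suitable minimal polynomial in a basis *)

Section RealJordanForm.
Variables (R : realType) (V : vectType R) (phi : 'End(V)).
Local Notation n := (\dim {:V}).

(** Divisibility forces equality, both polynomials being monic of degree [n]. The matrix of [phi]
    and [T^T] then both have cyclic vectors for the same polynomial. *)
Lemma jordan_basis (T : 'M[R]_n) c :
    nonderogatory phi -> has_minpoly T c -> c %| char_poly_end phi ->
  exists2 e : n.-tuple V, basis_of {:V} e & mx_in e phi = T.
Proof.
move=> nd mT cd; have mA := has_minpoly_char nd.
have cE : c = char_poly (mx_ref phi).
  case: mT => mc sc _ _; apply: monic_dvd_size_eq cd => //.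
    exact: char_poly_monic.
  by rewrite size_char_poly.
have {mT} mT : has_minpoly T^T (char_poly (mx_ref phi)).
  by rewrite -cE; apply: has_minpoly_tr.
have [s [sE /allP s0 pw]] := real_factorization (char_poly_monic (mx_ref phi)).
have irr x : x \in s -> irreducible_poly (real_min x.1) /\ (0 < x.2)%N.
  by move/s0; split=> //; apply: real_min_irreducible.
have [v vP] := cyclic_vector mA sE irr pw.
have [w wP] := cyclic_vector mT sE irr pw.
have [P uP PA] := cyclic_similar mA vP mT wP.
exact: mx_in_similar PA.
Qed.

Lemma ceigenvalueE z : ceigenvalue phi z = (real_min z %| char_poly_end phi).
Proof.
by rewrite /ceigenvalue eigenvalue_root_char -map_char_poly real_min_dvd.
Qed.

End RealJordanForm.

Lemma real_min_conj (R : rcfType) (z : R[i]) : real_min (conjc z) = real_min z.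
Proof. by case: z => a b; rewrite /real_min /= oppr_eq0 sqrrN. Qed.

Lemma coprime_conj_pairs (R : realType) m (lambda : 'I_m -> R[i])
    (i j : 'I_m) : distinct_conj_pairs lambda -> (i < j)%N ->
  coprimep (real_min (lambda i)) (real_min (lambda j)).
Proof.
case=> _; rewrite cat_uniq => /and3P[/injectiveP inj_lambda /hasPn dis _] ij.
apply: coprime_real_min.
  by apply: contraTneq ij => /inj_lambda ->; rewrite ltnn.
apply: contraTneq isT => ji.
have /dis := codom_f (fun j => conjc (lambda j)) i.
by rewrite -ji [_ \in _]codom_f.
Qed.

Lemma jformB_minpoly (R : realType) m (lambda : 'I_m -> R[i]) n
    (hn : (\sum_(j < m) 2)%N = n) : distinct_conj_pairs lambda ->
  has_minpoly (castmx (hn, hn) (jformB lambda)) (\prod_j real_min (lambda j)).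
Proof.
move=> dl; apply/has_minpoly_cast/has_minpoly_mxdiag => [i|i j].
  by apply: Jmx_minpoly; case: dl.
exact: coprime_conj_pairs.
Qed.

(** A real [z] gives form (A). A nonreal [z] gives a single pair in form (B) if [m = 1], and form
    (C) if [m >= 2], where the size [2m] is at least 4. *)
Lemma jordan_block_exists (R : realType) (z : R[i]) m : (0 < m)%N ->
  exists B : 'M[R]_(m * (size (real_min z)).-1),
    jordan_block B /\ has_minpoly B (real_min z ^+ m).
Proof.
move=> m0; rewrite size_real_min; have [z0|z0] := boolP (complex.Im z == 0).
  exists (jformA _ (complex.Re z)); split; first exact: BlockA.
  rewrite /= muln1 /real_min z0; exact: jformA_minpoly.
have [m1|m1] := eqVneq m 1%N.
  have hn : (\sum_(j < 1) 2 = m * 2)%N by rewrite m1 big_ord1.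
  have dz : distinct_conj_pairs (fun _ : 'I_1 => z).
    split=> //; have e1 : enum 'I_1 = [:: ord0].
      by apply: (inj_map val_inj); rewrite val_enum_ord.
    rewrite /image_mem !e1 /= inE andbT; case: (z) z0 => a b /= b0.
    by rewrite eq_complex /= eqxx /= -addr_eq0 -mulr2n mulrn_eq0.
  exists (castmx (hn, hn) (jformB (fun _ => z))); split.
    exact: BlockB dz _.
  have <- : \prod_(j < 1) real_min z = real_min z ^+ m by rewrite m1 big_ord1.
  exact: jformB_minpoly.
exists (jformC _ (complex.Re z) (complex.Im z)); split.
  apply: BlockC; rewrite // ?oddM ?andbF //= ; lia.
have := @jformC_minpoly R (m * 2) (complex.Re z) (complex.Im z) z0.
rewrite muln2 doubleK odd_double double_gt0 => /(_ m0 isT).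
by case: (z).
Qed.

Theorem theorem7 (R : realType) (V : vectType R) (phi : 'End(V)) :
  let n : nat := \dim {:V} in
  nonderogatory phi ->
  [/\ (forall lambda : R,
         (forall z : R[i], ceigenvalue phi z <-> z = real_complex R lambda) ->
         mup lambda (char_poly_end phi) = n ->
         exists2 e : n.-tuple V, basis_of {:V} e & mx_in e phi = jformA n lambda),

      (forall (m : nat) (lambda : 'I_m -> R[i])
              (hn : (\sum_(j < m) 2)%N = n),
         distinct_conj_pairs lambda ->
         (forall z : R[i], ceigenvalue phi z <->
            exists j, z = lambda j \/ z = conjc (lambda j)) ->
         exists2 e : n.-tuple V, basis_of {:V} e &
           mx_in e phi = castmx (hn, hn) (jformB lambda)),

      (forall r s : R,
         s != 0 -> (4 <= n)%N ->
         (forall z : R[i], ceigenvalue phi z <->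
            z = Complex r s \/ z = conjc (Complex r s)) ->
         exists2 e : n.-tuple V, basis_of {:V} e & mx_in e phi = jformC n r s)
    & exists (k : nat) (p : 'I_k -> nat) (B : forall i : 'I_k, 'M[R]_(p i))
             (hn : (\sum_(i < k) p i)%N = n) (e : n.-tuple V),
        [/\ basis_of {:V} e,
            (forall i, (0 < p i)%N),
            (forall i, jordan_block (B i))
          & mx_in e phi = castmx (hn, hn) (\mxdiag_(i < k) B i)]].
Proof.
move=> n nd; set c := char_poly_end phi.
have mc : c \is monic by apply: char_poly_monic.
have sc : size c = n.+1 by apply: size_char_poly.
split.
- move=> a eig mu.
  (* The eigenvalue [a] makes [c] nonconstant, which excludes dimension 0. *)
  have n0 : (0 < n)%N.
    have : real_min (real_complex R a) %| c by rewrite -ceigenvalueE; apply/eig.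
    move/(dvdp_leq (monic_neq0 mc)); rewrite sc size_real_min.
    by case: ifP => _ //; apply: ltnW.
  apply: jordan_basis (jformA_minpoly a n0) _ => //.
  by rewrite -mup_geq ?monic_neq0 // -/c mu.
- move=> m lambda hn dl eig.
  apply: jordan_basis (jformB_minpoly hn dl) _ => //.
  (* The factors of distinct conjugate pairs are coprime, so each may be shown to divide [c]
     separately. *)
  apply: prod_ord_coprime_dvd => [i j|j]; first exact: coprime_conj_pairs.
  by rewrite -ceigenvalueE; apply/eig; exists j; left.
- move=> r s s0 n4 eig; set z := Complex r s in eig *.
  have sz : size (real_min z) = 3 by rewrite size_real_min /= (negPf s0).
  have [|k [u [zu cE]]] := max_pow_factor (q := real_min z) (monic_neq0 mc).
    by rewrite sz.
  have mu : u \is monic.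
    by rewrite -(monicMl _ (monic_exp k (real_min_monic z))) -cE.
  (* Otherwise [u] has a complex root, which is an eigenvalue, hence [z] or its conjugate; then
     [real_min z] divides [u]. *)
  have u1 : u = 1.
    apply/eqP; apply: contraNT zu => u1.
    have [w [l [t [l0 _ uE _]]]] := real_root_factor mu u1.
    have wu : real_min w %| u.
      by rewrite uE -(prednK l0) exprS -mulrA dvdp_mulr.
    have : ceigenvalue phi w by rewrite ceigenvalueE -/c cE dvdp_mull.
    by case/eig=> wE; move: wu; rewrite wE ?real_min_conj.
  (* Comparing degrees in [c = real_min z ^+ k] yields the evenness of [n]. *)
  have nk : n = k.*2.
    apply: succn_inj; rewrite -sc cE u1 mulr1.
    rewrite -[LHS]prednK ?size_poly_gt0 ?expf_neq0 ?monic_neq0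
      ?real_min_monic //.
    by rewrite size_exp sz mul2n.
  have en : ~~ odd n by rewrite nk odd_double.
  apply: jordan_basis (jformC_minpoly r s0 _ en) _ => //.
    exact: leq_trans n4.
  by rewrite -/c cE nk doubleK dvdp_mulr.
have [s [cE /allP s0 pw]] := real_factorization mc.
pose x (i : 'I_(size s)) := tnth (in_tuple s) i.
have xs i : x i \in s by apply: mem_tnth.
have [B BP] :=
  fin_all_exists (fun i => jordan_block_exists (x i).1 (s0 _ (xs i))).
have mB := has_minpoly_mxdiag (fun i => proj2 (BP i)) _.
have cx : c = \prod_i real_min (x i).1 ^+ (x i).2 by rewrite cE big_tnth.
have {mB} mB : has_minpoly (\mxdiag_i B i) c.
  rewrite cx; apply: mB => i j ij.
  pose x0 : R[i] * nat := (0, 0%N).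
  rewrite /x !(tnth_nth x0) /=.
  by move/(pairwiseP x0): pw; apply; rewrite ?inE.
(* The block sizes add up to [n] because [has_minpoly] ties the size of [c] to that of the
   matrix. *)
have hn : (\sum_i (x i).2 * (size (real_min (x i).1)).-1)%N = n.
  by apply: succn_inj; rewrite -sc; case: mB.
have [e be eP] := jordan_basis nd (has_minpoly_cast hn mB) (dvdpp _).
exists (size s), _, B, hn, e; split=> // i; last exact: (proj1 (BP i)).
by rewrite muln_gt0 (s0 _ (xs i)) size_real_min; case: ifP.
Qed.
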